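(* Let $X$ be a normal space which is locally null with respect to an ideal $\mathscr{I}$ of an upper semi-lattice $(\mathscr{L},\subseteq)$, where $\mathscr{L}\subseteq\mathscr{P}(X)$. Then $C^{\mathscr I}_0(X)$ is a Banach algebra isometrically isomorphic to $C_0(Y)$ for some unique (up to homeomorphism) locally compact Hausdorff space $Y$, namely $Y=\lambda_{\mathscr I} X$. Furthermore: (1) $X$ is dense in $Y$ (in particular $X\subseteq Y$). (2) $C^{\mathscr I}_0(X)$ is of empty hull. (3) $C^{\mathscr I}_{00}(X)$ is dense in $C^{\mathscr I}_0(X)$. (4) $C^{\mathscr I}_0(X)$ is unital if and only if $\mathscr{I}$ is non-proper if and only if $Y$ is compact.
   Context: A space is a topological space; normal spaces are taken to be Hausdorff, so that the Stone–Čech compactification $\beta X$ exists and contains $X$ as a dense subspace. $\mathscr{P}(X)$ is the power set of $X$. $C_b(X)$ is the normed algebra of continuous bounded $f:X\to\mathbb{R}$ with pointwise operations and the supremum norm. For $f\in C_b(X)$: $\mathrm{z}(f)=f^{-1}(0)$, $\mathrm{coz}(f)=X\setminus\mathrm{z}(f)$, $\mathrm{supp}(f)=\mathrm{cl}_X\mathrm{coz}(f)$. $\mathrm{Coz}(X)$ is the set of all cozero-sets $\mathrm{coz}(f)$ of continuous real-valued functions on $X$. $C_0(Y)$ is the set of $f\in C_b(Y)$ vanishing at infinity, i.e. with $|f|^{-1}([1/n,\infty))$ compact for each positive integer $n$. ''Isometrically isomorphic'' means by an isometric algebra isomorphism. An upper semi-lattice is a partially ordered set in which any two elements $A,B$ have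 a least upper bound $A\vee B$. For $\mathscr{L}\subseteq\mathscr{P}(X)$ ordered by inclusion, $A\vee B$ is computed in $\mathscr{L}$ and need not equal $A\cup B$. An ideal $\mathscr{I}$ in $(\mathscr{L},\subseteq)$ is a non-empty subset of $\mathscr{L}$ such that $A\vee B\in\mathscr{I}$ whenever $A,B\in\mathscr{I}$, and $T\in\mathscr{I}$ whenever $T\in\mathscr{L}$ and $T\subseteq A$ for some $A\in\mathscr{I}$. Elements of $\mathscr{I}$ are called null; $\mathscr{I}$ is proper if $X$ is not null, and non-proper if $X\in\mathscr{I}$. A neighborhood of a set $A$ in $X$ is a set $U\subseteq X$ with $A\subseteq\mathrm{int}_XU$. $X$ is locally null (with respect to $\mathscr{I}$) if every point of $X$ has a null neighborhood in $X$. $C^{\mathscr I}_{00}(X)=\{f\in C_b(X):\mathrm{supp}(f)\text{ has a null neighborhood in }X\}$. $C^{\mathscr I}_0(X)=\{f\in C_b(X):|f|^{-1}([1/n,\infty))\text{ has a null neighborhood in }X\text{ for each positive integer }n\}$. $\lambda_{\mathscr I} X=\bigcup\{\mathrm{int}_{\beta X}\mathrm{cl}_{\beta X}C: C\in\mathrm{Coz}(X)\text{ and }\mathrm{cl}_XC\text{ has a null neighborhood in }X\}$, considered as a subspace of $\beta X$. An ideal $H$ of $C_b(X)$ is of empty hull if for every $x\in X$ there is $h\in H$ with $h(x)\neq0$. An algebra is unital if it has a multiplicative unit element. *)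

(* Defs.v *)
From HB Require Import structures.
From mathcomp Require Import all_boot all_order all_algebra.
From mathcomp Require Import all_classical all_reals all_analysis.
Set Implicit Arguments.
Unset Strict Implicit.
Unset Printing Implicit Defensive.
Import Order.TTheory GRing.Theory Num.Theory.
Import numFieldNormedType.Exports.
Local Open Scope classical_set_scope.
Local Open Scope ring_scope.

(* The library has no algebras without a unit.  The algebras below are sets of
   functions closed under the pointwise operations of X -> R. *)
Section function_algebras.
Context {R : realType} {X : topologicalType}.
Implicit Types (f g : X -> R) (A : set (X -> R)).

Definition Cb : set (X -> R) := [set f | continuous f /\ bounded_fun f].

(* [sup] is 0 on the empty set, so this is also right when X is empty. *)
Definition supnorm f : R := sup (range (fun x => `|f x|)).

Definition coz f : set X := ~` (f @^-1` [set 0]).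

Definition supp f : set X := closure (coz f).

(* The set |f|^{-1}([1/n, +oo)). *)
Definition level f (n : nat) : set X :=
  (fun x => `|f x|) @^-1` `[n%:R^-1, +oo[%classic.

Definition C0 : set (X -> R) :=
  [set f | Cb f /\ forall n : nat, (0 < n)%N -> compact (level f n)].

Definition subalgebra A :=
  [/\ A 0,
      forall f g, A f -> A g -> A (f + g),
      forall (k : R) f, A f -> A (k *: f) &
      forall f g, A f -> A g -> A (f * g)].

Definition algebra_norm A (N : (X -> R) -> R) :=
  [/\ forall f, A f -> 0 <= N f,
      forall f, A f -> N f = 0 -> f = 0,
      forall (k : R) f, A f -> N (k *: f) = `|k| * N f,
      forall f g, A f -> A g -> N (f + g) <= N f + N g &
      forall f g, A f -> A g -> N (f * g) <= N f * N g].

Definition norm_complete A (N : (X -> R) -> R) :=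
  forall u : nat -> X -> R, (forall n, A (u n)) ->
  (forall e : R, 0 < e ->
    exists M : nat, forall m n, (M <= m)%N -> (M <= n)%N -> N (u m - u n) < e) ->
  exists2 f, A f & (fun n => N (u n - f)) @ \oo --> (0 : R).

Definition banach_algebra A (N : (X -> R) -> R) :=
  [/\ subalgebra A, algebra_norm A N & norm_complete A N].

Definition unital A :=
  exists2 u, A u & forall f, A f -> u * f = f /\ f * u = f.

Definition Cb_ideal A :=
  [/\ A `<=` Cb, subalgebra A & forall f h, Cb f -> A h -> A (f * h)].

Definition empty_hull A :=
  Cb_ideal A /\ forall x, exists2 h, A h & h x != 0.

Definition supnorm_dense A B :=
  A `<=` B /\
  forall f, B f -> forall e : R, 0 < e -> exists2 g, A g & supnorm (f - g) < e.

End function_algebras.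
Arguments Cb : clear implicits.
Arguments C0 : clear implicits.

Definition isometrically_isomorphic {R : realType} {X Y : topologicalType}
    (A : set (X -> R)) (B : set (Y -> R)) :=
  exists Phi : (X -> R) -> (Y -> R),
    [/\ set_bij A B Phi,
        forall f g, A f -> A g -> Phi (f + g) = Phi f + Phi g,
        forall (k : R) f, A f -> Phi (k *: f) = k *: Phi f,
        forall f g, A f -> A g -> Phi (f * g) = Phi f * Phi g &
        forall f, A f -> supnorm (Phi f) = supnorm f].

Definition homeomorphic (X Y : topologicalType) :=
  exists (f : X -> Y) (g : Y -> X),
    [/\ continuous f, continuous g, cancel f g & cancel g f].

Definition topological_embedding {X Y : topologicalType} (f : X -> Y) :=
  injective f /\
  forall U : set X, open U <-> exists2 V : set Y, open V & f @^-1` V = U.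

Section set_ideals.
Context {X : Type}.
Implicit Types (L I : set (set X)) (A B C : set X).

Definition is_join L A B C :=
  [/\ L C, A `<=` C, B `<=` C &
      forall D, L D -> A `<=` D -> B `<=` D -> C `<=` D].

Definition upper_semilattice L :=
  forall A B, L A -> L B -> exists C, is_join L A B C.

Definition set_ideal L I :=
  [/\ I !=set0, I `<=` L,
      forall A B C, I A -> I B -> is_join L A B C -> I C &
      forall A T, I A -> L T -> T `<=` A -> I T].

End set_ideals.

Section null_sets.
Context {R : realType} {X : topologicalType}.
Implicit Types I : set (set X).

Definition has_null_nbhd I (A : set X) := exists2 U, I U & A `<=` U°.

Definition locally_null I := forall x : X, has_null_nbhd I [set x].

Definition C00I I : set (X -> R) :=
  [set f | Cb R X f /\ has_null_nbhd I (supp f)].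

Definition C0I I : set (X -> R) :=
  [set f | Cb R X f /\
           forall n : nat, (0 < n)%N -> has_null_nbhd I (level f n)].

End null_sets.
Arguments C00I R {X} I.
Arguments C0I R {X} I.

Section stone_cech.
Context (R : realType) (X : topologicalType).

(* The Stone-Cech compactification of X, as the closure in the product
   R^(C_b(X)) of the image of X under x |-> (f(x))_f. *)
Definition Cb_eval (x : X) : prod_topology (fun _ : Cb R X => R) :=
  fun f => val f x.

Definition beta : set (prod_topology (fun _ : Cb R X => R)) :=
  closure (range Cb_eval).

Lemma beta_Cb_eval (x : X) : Cb_eval x \in beta.
Proof. by apply/mem_set/subset_closure; exists x. Qed.

Definition to_beta (x : X) : beta := SigSub (beta_Cb_eval x).

Definition Coz : set (set X) :=
  [set C | exists2 f : X -> R, continuous f & C = coz f].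

Definition lambda (I : set (set X)) : set beta :=
  \bigcup_(C in [set C | Coz C /\ has_null_nbhd I (closure C)])
    (closure (to_beta @` C))°.

End stone_cech.
Arguments beta : clear implicits.
Arguments to_beta R {X} x.
Arguments lambda R {X} I.

(* Main.v *)
Require Import Defs.
From HB Require Import structures.
From mathcomp Require Import all_boot all_order all_algebra.
From mathcomp Require Import all_classical all_reals all_analysis.
From mathcomp Require Import ring lra.
Set Implicit Arguments.
Unset Strict Implicit.
Unset Printing Implicit Defensive.
Import Order.TTheory GRing.Theory Num.Theory.
Import numFieldNormedType.Exports.
Local Open Scope classical_set_scope.
Local Open Scope ring_scope.

(** Write Y for lambda_I X.  Everything rests on one description of Y: a point
    p of beta X lies in Y exactly when the continuous extension of some f in
    C^I_0(X) is nonzero at p (lambdaP).  If p is interior to the closure of a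
    cozero set C whose closure in X has a null neighborhood, Urysohn's lemma
    gives a function of C^I_0(X) equal to 1 on C, hence at p; conversely the
    cozero set where |f| exceeds half of |f(p)| witnesses that p is in Y.

    A point of beta X is a function on C_b(X), so the extension of f is
    evaluation at f.  For f in C^I_0(X) the set of p in beta X with
    |f(p)| >= 1/n is closed in the compact space beta X and contained in Y;
    therefore extension followed by restriction to Y maps C^I_0(X) into C_0(Y)
    (lambda_ext_C0), and it is an isometric homomorphism because X is dense in
    Y.  It is onto: given g in C_0(Y), the compact set where |g| >= 1/n is
    covered by finitely many open sets whose traces on X have null
    neighborhoods, and having a null neighborhood is stable under finite
    unions, so that g restricts to a member of C^I_0(X) (C0_restrict).  Local
    null-ness puts X inside Y and gives the empty hull.  Unitality,
    non-properness of the ideal and compactness of Y all say that the constant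
    function 1 belongs to C^I_0(X).

    Both C_0(Y) and C^I_0(X) consist of the bounded continuous functions whose
    sets |f| >= 1/n belong to a family closed under finite unions and closed
    subsets.  The Banach algebra axioms are proved once in that generality
    (vanishing_banach).

    Uniqueness of Y is the Banach-Stone theorem for C_0 spaces (banach_stone).
    A nonzero contractive character of C_0(Z) is evaluation at a point: if
    phi(g) = 1, an element f of the kernel must be small somewhere on the
    compact set |g| >= 1/2, for otherwise g / (1 + s f^2), on which phi is
    again 1, would have norm less than 1 for s the norm of g.  A cluster point
    of these sets of smallness is a common zero of the kernel.  An isometric
    isomorphism between C_0 spaces thus moves points, continuously because
    C_0 bump functions generate the topology of a locally compact Hausdorff
    space. *)

(** * Bounded continuous functions and the supremum norm *)

Section bounded_functions.
Context {R : realType} {X : topologicalType}.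
Implicit Types f g : X -> R.

Lemma bounded_funP f :
  bounded_fun f <-> exists2 M : R, 0 <= M & forall x, `|f x| <= M.
Proof.
split=> [/pinfty_ex_gt0[M M0 fM]|[M M0 fM]].
  by exists M; [exact: ltW | move=> x; exact: fM].
exists M; split; first exact: ger0_real.
by move=> N /ltW MN x _; exact: le_trans (fM x) MN.
Qed.

Lemma supnorm_ub f x : Cb R X f -> `|f x| <= supnorm f.
Proof.
case=> _ /bounded_funP[M _ fM]; apply: ub_le_sup; last by exists x.
by exists M => _ [y _ <-]; exact: fM.
Qed.

Lemma supnorm_empty f : ~ ([set: X] !=set0) -> supnorm f = 0.
Proof.
move=> X0; rewrite /supnorm; suff -> : [set `|f x| | x in [set: X]] = set0.
  exact: sup0.
by apply/seteqP; split=> // z [y _ _]; case: X0; exists y.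
Qed.

Lemma supnorm_le f (M : R) : 0 <= M -> (forall x, `|f x| <= M) -> supnorm f <= M.
Proof.
move=> M0 fM; have [[x _]|X0] := pselect ([set: X] !=set0).
  by apply: ge_sup => [|_ [y _ <-]]; [exists `|f x|, x | exact: fM].
by rewrite supnorm_empty.
Qed.

Lemma supnorm_ge0 f : Cb R X f -> 0 <= supnorm f.
Proof.
move=> fb; have [[x _]|X0] := pselect ([set: X] !=set0).
  exact: le_trans (supnorm_ub x fb).
by rewrite supnorm_empty.
Qed.

Lemma continuous_Cb f (M : R) :
  continuous f -> 0 <= M -> (forall x, `|f x| <= M) -> Cb R X f.
Proof. by move=> cf M0 fM; split=> //; apply/bounded_funP; exists M. Qed.

Lemma Cb_bound f : Cb R X f -> exists2 M : R, 0 <= M & forall x, `|f x| <= M.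
Proof. by case=> _ /bounded_funP. Qed.

Lemma Cb_cst (k : R) : Cb R X (fun=> k).
Proof. by apply: (@continuous_Cb _ `|k|) => // x; exact: cvg_cst. Qed.

Lemma CbD f g : Cb R X f -> Cb R X g -> Cb R X (f + g).
Proof.
move=> fb gb; have [M M0 fM] := Cb_bound fb; have [N N0 gN] := Cb_bound gb.
apply: (@continuous_Cb _ (M + N)); [|exact: addr_ge0|].
  by move=> x; apply: continuousD; [exact: fb.1|exact: gb.1].
by move=> x; rewrite fctE (le_trans (ler_normD _ _))// lerD.
Qed.

Lemma CbM f g : Cb R X f -> Cb R X g -> Cb R X (f * g).
Proof.
move=> fb gb; have [M M0 fM] := Cb_bound fb; have [N N0 gN] := Cb_bound gb.
apply: (@continuous_Cb _ (M * N)); [|exact: mulr_ge0|].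
  by move=> x; apply: continuousM; [exact: fb.1|exact: gb.1].
by move=> x; rewrite fctE normrM ler_pM.
Qed.

Lemma CbZ k f : Cb R X f -> Cb R X (k *: f).
Proof. by move=> fb; apply: (@CbM (fun=> k)) => //; exact: Cb_cst. Qed.

Lemma CbB f g : Cb R X f -> Cb R X g -> Cb R X (f - g).
Proof.
by move=> fb gb; rewrite -scaleN1r; apply: CbD => //; exact: CbZ.
Qed.

Lemma uniform_separator_Cb (A B : set X) : uniform_separator A B ->
  exists f, [/\ Cb R X f, forall x, A x -> f x = 0 & forall x, B x -> f x = 1].
Proof.
move=> /(@uniform_separatorP _ R)[f [cf f01 fA fB]]; exists f; split.
- apply: (@continuous_Cb f 1) => // x.
  have : `[0%R, 1%R]%classic (f x) by apply: f01; exists x.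
  by rewrite /= in_itv/= => /andP[f0 f1]; rewrite ger0_norm.
- by move=> x Ax; apply: fA; exists x.
- by move=> x Bx; apply: fB; exists x.
Qed.

Lemma closed_norm_ge f (e : R) : continuous f -> closed [set x | e <= `|f x|].
Proof.
move=> cf; apply: (@closed_comp _ _ (fun x => `|f x|) [set y | e <= y]).
  by move=> x _; apply: (continuous_comp (cf x)); exact: norm_continuous.
exact: closed_ge.
Qed.

Lemma open_norm_gt f (e : R) : continuous f -> open [set x | e < `|f x|].
Proof.
move=> cf; apply: (@open_comp _ _ (fun x => `|f x|) [set y | e < y]).
  by move=> x _; apply: (continuous_comp (cf x)); exact: norm_continuous.
exact: open_gt.
Qed.

Lemma closed_level f n : continuous f -> closed (level f n).
Proof.
move=> cf; apply: closed_comp => [x _|]; last exact: interval_closed.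
by apply: (continuous_comp (cf x)); exact: norm_continuous.
Qed.

Lemma levelE f n x : level f n x = (n%:R^-1 <= `|f x|) :> Prop.
Proof. by rewrite /level /preimage/= in_itv/= andbT. Qed.

Lemma level_neq0 f n x : (0 < n)%N -> level f n x -> f x != 0.
Proof.
move=> n0; rewrite levelE -normr_gt0; apply: lt_le_trans.
by rewrite invr_gt0 ltr0n.
Qed.

End bounded_functions.

Lemma invn_double (R : realType) (n : nat) : (0 < n)%N ->
  n.*2%:R^-1 + n.*2%:R^-1 = n%:R^-1 :> R.
Proof.
by move=> n0; rewrite -muln2 natrM; field; rewrite pnatr_eq0 -lt0n.
Qed.

(** * Functions vanishing along a family of sets *)

Section vanishing.
Context {R : realType} {X : topologicalType} (P : set (set X)).
Hypothesis P0 : P set0.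
Hypothesis PU : forall A B, P A -> P B -> P (A `|` B).
Hypothesis PS : forall A B, closed A -> A `<=` B -> P B -> P A.
Implicit Types f g : X -> R.

(** C_0(X) is the case where P is compactness, and C^I_0(X) the case where P
    says that a set has a null neighborhood. *)
Definition vanishing : set (X -> R) :=
  [set f | Cb R X f /\ forall n : nat, (0 < n)%N -> P (level f n)].

(** Bounds by arbitrary positive reals suffice: the level 1/n is below e as soon
    as n exceeds 1/e. *)
Lemma vanishing_level f (e : R) A : vanishing f -> 0 < e -> closed A ->
  (forall x, A x -> e <= `|f x|) -> P A.
Proof.
move=> [fb fP] e0 cA Af.
have n0 : (0 < (Num.truncn e^-1).+1)%N by [].
apply: (PS cA _ (fP _ n0)) => x /Af; rewrite levelE; apply: le_trans.
by rewrite invf_ple ?posrE// ltW// truncnS_gt.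
Qed.

Lemma vanishing_le f g (k : R) : vanishing f -> Cb R X g ->
  (forall x, `|g x| <= k * `|f x|) -> vanishing g.
Proof.
move=> fv gb gf; split=> // n n0.
have k0 : 0 < `|k| + 1 by rewrite ltr_wpDl.
apply: (@vanishing_level f (n%:R^-1 / (`|k| + 1)) _ fv).
- by rewrite divr_gt0// invr_gt0 ltr0n.
- by apply: closed_level; exact: gb.1.
- move=> x; rewrite levelE => gx; rewrite ler_pdivrMr// (le_trans gx)//.
  rewrite (le_trans (gf x))// mulrC ler_wpM2l// (le_trans (ler_norm _))//.
  by rewrite lerDl.
Qed.

Lemma vanishing0 : vanishing 0.
Proof.
split=> [|n n0]; first exact: Cb_cst.
rewrite (_ : level _ _ = set0)// -subset0 => x /(level_neq0 n0).
by rewrite eqxx.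
Qed.

(** Where |f + g| >= 1/n, one of |f| and |g| is at least 1/(2n). *)
Lemma vanishingD f g : vanishing f -> vanishing g -> vanishing (f + g).
Proof.
move=> fv gv; split=> [|n n0]; first exact: CbD fv.1 gv.1.
have m0 : (0 < n.*2)%N by rewrite double_gt0.
apply: (PS _ _ (PU (fv.2 _ m0) (gv.2 _ m0))).
  by apply: closed_level; exact: (CbD fv.1 gv.1).1.
move=> x; rewrite levelE fctE => fgx; rewrite /setU/=.
have [fx|fx] := leP (n.*2%:R^-1) `|f x|; first by left; rewrite levelE.
right; rewrite levelE leNgt; apply/negP => gx.
move: fgx; rewrite leNgt => /negP; apply.
apply: le_lt_trans (ler_normD _ _) _; apply: lt_le_trans (ltrD fx gx) _.
by rewrite invn_double.
Qed.

Lemma vanishingMl f h : Cb R X f -> vanishing h -> vanishing (f * h).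
Proof.
move=> fb hv; apply: (@vanishing_le h _ (supnorm f)) => //.
  exact: CbM fb hv.1.
by move=> x; rewrite fctE normrM ler_wpM2r// supnorm_ub.
Qed.

Lemma vanishingZ k f : vanishing f -> vanishing (k *: f).
Proof. by move=> fv; apply: (@vanishingMl (fun=> k)) => //; exact: Cb_cst. Qed.

Lemma vanishingB f g : vanishing f -> vanishing g -> vanishing (f - g).
Proof.
by move=> fv gv; rewrite -scaleN1r; apply: vanishingD => //; exact: vanishingZ.
Qed.

Lemma vanishing_subalgebra : subalgebra vanishing.
Proof.
split; [exact: vanishing0|exact: vanishingD|exact: vanishingZ|].
by move=> f g fv gv; exact: vanishingMl fv.1 gv.
Qed.

Lemma vanishing_ideal : Cb_ideal vanishing.
Proof.
by split; [move=> f []|exact: vanishing_subalgebra|exact: vanishingMl].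
Qed.

Lemma vanishing_norm : algebra_norm vanishing supnorm.
Proof.
split.
- by move=> f [fb _]; exact: supnorm_ge0.
- move=> f [fb _] f0; apply/funext => x; apply/eqP.
  by rewrite -normr_le0 -f0 supnorm_ub.
- move=> k f fv; have kfb := (vanishingZ k fv).1; have fb := fv.1.
  apply/eqP; rewrite eq_le; apply/andP; split.
    apply: supnorm_le => [|x]; first by rewrite mulr_ge0// supnorm_ge0.
    by rewrite fctE normrM ler_wpM2l// supnorm_ub.
  have [->|k0] := eqVneq k 0.
    by rewrite normr0 mul0r supnorm_ge0//; exact: (vanishingZ 0 fv).1.
  rewrite mulrC -ler_pdivlMr ?normr_gt0//; apply: supnorm_le => [|x].
    by rewrite divr_ge0// supnorm_ge0.
  by rewrite ler_pdivlMr ?normr_gt0// mulrC -normrM (supnorm_ub x kfb).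
- move=> f g [fb _] [gb _].
  apply: supnorm_le => [|x]; first by rewrite addr_ge0// supnorm_ge0.
  by rewrite fctE (le_trans (ler_normD _ _))// lerD// supnorm_ub.
- move=> f g [fb _] [gb _].
  apply: supnorm_le => [|x]; first by rewrite mulr_ge0// supnorm_ge0.
  by rewrite fctE normrM ler_pM// supnorm_ub.
Qed.

(** A Cauchy sequence converges uniformly to its pointwise limit f, and the set
    |f| >= 1/n lies in the set |u_m| >= 1/(2n) once u_m is within 1/(2n)
    of f. *)
Lemma vanishing_complete : norm_complete vanishing supnorm.
Proof.
move=> u uv uC; pose f x := limn (fun n => u n x).
have uM e : 0 < e -> exists M, forall m n, (M <= m)%N -> (M <= n)%N ->
    forall x, `|u m x - u n x| <= e.
  move=> /uC[M HM]; exists M => m n Mm Mn x.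
  have := supnorm_ub x (vanishingB (uv m) (uv n)).1.
  by move/le_trans; apply; exact/ltW/HM.
have uf x : (fun n => u n x) @ \oo --> f x.
  apply/cauchy_cvgP; apply: cauchy_exP => e e0.
  have [M HM] := uM _ (divr_gt0 e0 (ltr0n R 2)).
  exists (u M x); exists M => // n /= Mn; rewrite /ball/=.
  rewrite (le_lt_trans (HM _ _ (leqnn M) Mn x))//.
  by rewrite ltr_pdivrMr// ltr_pMr// ltr1n.
have fM e : 0 < e -> exists M, forall n, (M <= n)%N ->
    forall x, `|u n x - f x| <= e.
  move=> e0; have [M HM] := uM _ (divr_gt0 e0 (ltr0n R 2)).
  exists M => n Mn x.
  have /cvgrPdist_lt/(_ _ (divr_gt0 e0 (ltr0n R 2)))[N _ HN] := uf x.
  rewrite -(subrKA (u (maxn M N) x)) (le_trans (ler_normD _ _))//.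
  rewrite (splitr e) lerD ?HM// ?leq_maxl// distrC ltW//.
  by apply: HN => /=; rewrite leq_maxr.
(* |f x - f y| is cut at u_M x and u_M y into three pieces below e / 3. *)
have cf : continuous f.
  move=> x; apply/cvgrPdist_lt => e e0.
  have [M HM] := fM _ (divr_gt0 e0 (ltr0n R 3)).
  have /cvgrPdist_lt/(_ _ (divr_gt0 e0 (ltr0n R 3))) := (uv M).1.1 x.
  apply: filterS => y uy; rewrite -(subrKA (u M x)) -[X in _ + X](subrKA (u M y)).
  have e3 : e = e / 3 + (e / 3 + e / 3) by field.
  rewrite [ltRHS]e3 (le_lt_trans (ler_normD _ _))// ler_ltD//.
    by rewrite distrC HM.
  by rewrite (le_lt_trans (ler_normD _ _))// ltr_leD// HM.
have fb : Cb R X f.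
  have [M /(_ M (leqnn M)) HM] := fM _ (@ltr01 R).
  apply: (@continuous_Cb _ _ f (supnorm (u M) + 1)) => //.
    by rewrite addr_ge0// supnorm_ge0//; exact: (uv M).1.
  move=> x; rewrite -[f x](subrK (u M x)) addrC (le_trans (ler_normD _ _))//.
  by rewrite lerD// ?(supnorm_ub x (uv M).1)// distrC.
exists f.
  split=> // n n0.
  have n2 : 0 < (n.*2%:R^-1 : R) by rewrite invr_gt0 ltr0n double_gt0.
  have [M /(_ M (leqnn M)) HM] := fM _ n2.
  apply: (vanishing_level (uv M) n2); first exact: closed_level.
  move=> x; rewrite levelE => fx; rewrite -(lerD2l n.*2%:R^-1) invn_double//.
  apply: le_trans fx _; rewrite -[f x](subrK (u M x)) (le_trans (ler_normD _ _))//.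
  by rewrite lerD2r distrC.
apply/cvgrPdist_le => e e0; have [M HM] := fM _ e0.
exists M => // n /= Mn; rewrite sub0r normrN ger0_norm.
  by apply: supnorm_le => [|x]; [exact: ltW | exact: HM].
by apply: supnorm_ge0; exact: CbB (uv n).1 fb.
Qed.

Lemma vanishing_banach : banach_algebra vanishing supnorm.
Proof.
split; [exact: vanishing_subalgebra|exact: vanishing_norm|].
exact: vanishing_complete.
Qed.

End vanishing.

(** * Sets with a null neighborhood *)

Section null_vanishing.
Context {R : realType} {X : topologicalType} (L I : set (set X)).
Hypotheses (semiL : upper_semilattice L) (idI : set_ideal L I).

Lemma has_null_nbhd0 : has_null_nbhd I set0.
Proof. by case: idI => -[U IU] _ _ _; exists U. Qed.

Lemma has_null_nbhdS A B : A `<=` B -> has_null_nbhd I B -> has_null_nbhd I A.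
Proof. by move=> AB [U IU BU]; exists U => //; exact: subset_trans BU. Qed.

(** The union of two null sets need not be null, but it is contained in their
    join, which is null. *)
Lemma has_null_nbhdU A B :
  has_null_nbhd I A -> has_null_nbhd I B -> has_null_nbhd I (A `|` B).
Proof.
case: idI => _ IL joinI _ [U IU AU] [V IV BV].
have [W UVW] := semiL (IL _ IU) (IL _ IV).
exists W; first exact: joinI UVW.
have [_ UW VW _] := UVW.
by rewrite subUset; split; [apply: subset_trans AU _|apply: subset_trans BV _];
  exact: interiorS.
Qed.

Lemma null_vanishing_banach : banach_algebra (C0I R I) supnorm.
Proof.
apply: vanishing_banach; [exact: has_null_nbhd0|exact: has_null_nbhdU|].
by move=> A B _; exact: has_null_nbhdS.
Qed.

End null_vanishing.

(** * Topological preliminaries *)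

Lemma hausdorff_closed1 (T : topologicalType) (t : T) :
  hausdorff_space T -> closed [set t].
Proof. by move=> /hausdorff_accessible/accessible_closed_set1; exact. Qed.

Section subtypes.
Context {T : topologicalType} (A : set T).

Lemma set_val_continuous : continuous (set_val : A -> T).
Proof. exact: initial_continuous. Qed.

Lemma nbhs_set_val (a : A) (U : set A) :
  nbhs a U -> exists2 V : set T, nbhs (set_val a) V & set_val @^-1` V `<=` U.
Proof.
move=> [_ /= [[V oV <-] Va VU]]; exists V => //.
exact: open_nbhs_nbhs.
Qed.

Lemma compact_set_val (K : set A) : compact (set_val @` K) -> compact K.
Proof.
move=> cK F PF FK.
have FI B : F B -> (set_val @ F) (set_val @` B).
  exact: (filterS (@preimage_image _ _ set_val B)).
have [_ [[a Ka <-] Fa]] := cK (set_val @ F) _ (FI _ FK).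
exists a; split=> // B U FB /nbhs_set_val[V Va VU].
have [_ [[b Bb <-] Vb]] := Fa _ V (FI _ FB) Va.
by exists b; split=> //; exact: VU.
Qed.

Lemma hausdorff_set_type : hausdorff_space T -> hausdorff_space A.
Proof.
move=> hT a b ab; apply: val_inj; apply: hT => U V Ua Vb.
have [c [Uc Vc]] := ab _ _ (set_val_continuous Ua) (set_val_continuous Vb).
by exists (set_val c).
Qed.

End subtypes.

Lemma continuous_eq_on_dense (S : Type) (T U : topologicalType) (i : S -> T)
    (u v : T -> U) : hausdorff_space U ->
  (forall (t : T) B, nbhs t B -> exists s, B (i s)) ->
  continuous u -> continuous v -> (forall s, u (i s) = v (i s)) -> u = v.
Proof.
move=> hU di cu cv uv; apply/funext => t; apply: hU => A B At Bt.
have At' : nbhs t (u @^-1` A) by exact: cu.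
have Bt' : nbhs t (v @^-1` B) by exact: cv.
have [s [As Bs]] := di _ _ (filterI At' Bt').
by exists (u (i s)); split=> //; rewrite uv.
Qed.

(** Finite subcovers in ideal form: a property of sets that passes to subsets
    and finite unions and holds near each point of a compact set holds for the
    whole set.  Otherwise the complements relative to K of the sets in J would
    form a proper filter without a cluster point in K. *)
Lemma compact_local_ideal (T : topologicalType) (J : set (set T)) (K : set T) :
  J set0 -> (forall A B, J A -> J B -> J (A `|` B)) ->
  (forall A B, A `<=` B -> J B -> J A) ->
  (forall t, K t -> exists2 V, nbhs t V & J V) -> compact K -> J K.
Proof.
move=> J0 JU JS JK cK; apply: contrapT => nJK.
pose F := [set A | J (K `\` A)].
have PF : ProperFilter F.
  split; first by rewrite /F/= setD0.
  split; first by rewrite /F/= setDT.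
    by move=> A B FA FB; rewrite /F/= setDIr; exact: JU.
  by move=> A B AB; apply: JS; exact: setDS.
have [|t [Kt Ft]] := cK F PF; first by rewrite /F/= setDv.
have [V Vt JV] := JK _ Kt.
have [|s []//] := Ft (~` V) V _ Vt.
by rewrite /F/= setDE setCK; apply: JS JV; exact: subIsetr.
Qed.

(** * The Stone-Cech compactification *)

Section stone_cech_compactification.
Context {R : realType} {X : topologicalType}.
Implicit Types (f g : X -> R) (p q : beta R X).

(** A point of beta X is its own table of values: the coordinate at f is the
    value of the continuous extension of f.  The default 0 is only reached by
    functions outside C_b(X). *)
Definition beta_ext f p : R :=
  if pselect (Cb R X f) is left fb then set_val p (SigSub (mem_set fb)) else 0.

Lemma beta_ext_continuous f : continuous (beta_ext f).
Proof.
rewrite /beta_ext; case: pselect => [fb|_]; last first.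
  exact: cst_continuous.
move=> p; apply: (@continuous_comp (beta R X)
  (prod_topology (fun _ : Cb R X => R)) R set_val
  (fun t => t (SigSub (mem_set fb)))).
  exact: set_val_continuous.
exact: (@proj_continuous (Cb R X) (fun=> R) (SigSub (mem_set fb))).
Qed.

Lemma beta_ext_to_beta f x : Cb R X f -> beta_ext f (to_beta R x) = f x.
Proof. by rewrite /beta_ext; case: pselect. Qed.

Lemma beta_ext_inj p q :
  (forall f, Cb R X f -> beta_ext f p = beta_ext f q) -> p = q.
Proof.
move=> pq; apply: val_inj; apply: functional_extensionality_dep => -[f fX].
have := pq f (set_mem fX); rewrite /beta_ext.
case: pselect => [fb|/(_ (set_mem fX))//].
by rewrite (Prop_irrelevance (mem_set fb) fX).
Qed.

Lemma beta_hausdorff : hausdorff_space (beta R X).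
Proof.
move=> p q pq; apply: beta_ext_inj => f _.
apply: (@Rhausdorff R) => A B Af Bf.
have [r [Ar Br]] := pq _ _ (beta_ext_continuous Af) (beta_ext_continuous Bf).
by exists (beta_ext f r).
Qed.

Lemma to_beta_continuous : continuous (@to_beta R X).
Proof.
move=> x U /nbhs_set_val[V Vx VU].
suff : \near x, V (@Cb_eval R X x).
  by apply: filterS => y Vy; exact: (VU (to_beta R y) Vy).
suff : @Cb_eval R X @ x --> @Cb_eval R X x by apply.
apply/cvg_sup => f W [_ /= [[V' oV' <-] V'x V'W]].
have fb := set_mem (valP f).
have : \near x, V' (val f x) by apply: fb.1; exact: open_nbhs_nbhs.
by apply: filterS => y V'y; exact: V'W.
Qed.

Lemma to_beta_dense p (B : set (beta R X)) :
  nbhs p B -> exists x, B (to_beta R x).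
Proof.
move=> /nbhs_set_val[V Vp VB].
have [_ [[x _ <-] Vx]] := set_mem (valP p) _ Vp.
by exists x; exact: (VB (to_beta R x)).
Qed.

Lemma eq_continuous_beta (T : topologicalType) (u v : beta R X -> T) :
  hausdorff_space T -> continuous u -> continuous v ->
  (forall x, u (to_beta R x) = v (to_beta R x)) -> u = v.
Proof.
by move=> hT; apply: (continuous_eq_on_dense hT) => p; exact: to_beta_dense.
Qed.

(** The extension satisfies the bounds of f, since X is dense and such bounds
    define closed sets. *)
Lemma beta_ext_le f (M : R) p : Cb R X f -> (forall x, `|f x| <= M) ->
  `|beta_ext f p| <= M.
Proof.
move=> fb fM; suff : closed [set q | `|beta_ext f q| <= M].
  apply=> B /to_beta_dense[x Bx]; exists (to_beta R x); split=> //=.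
  by rewrite beta_ext_to_beta.
apply: (closed_comp (f := fun q => `|beta_ext f q|) (D := [set y | y <= M])).
  move=> q _; apply: (continuous_comp (@beta_ext_continuous f q)).
  exact: norm_continuous.
exact: closed_le.
Qed.

(** Every coordinate f of a point lies in the segment of radius the norm of f,
    and a product of segments is compact. *)
Lemma beta_compact : compact [set: beta R X].
Proof.
apply: compact_set_val.
have cptI : compact [set t : prod_topology (fun _ : Cb R X => R) |
    forall f : Cb R X, `[- supnorm (val f), supnorm (val f)]%classic (t f)].
  apply: (@tychonoff (Cb R X) (fun=> R)
    (fun f : Cb R X => `[- supnorm (val f), supnorm (val f)]%classic)) => f.
  exact: segment_compact.
apply: (subclosed_compact _ cptI).
- rewrite (_ : set_val @` _ = beta R X); first exact: closed_closure.
  apply/seteqP; split=> [_ [p _ <-]|t bt]; first exact: set_valP.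
  by exists (SigSub (mem_set bt)).
- move=> _ [p _ <-] [f fX]; have fb := set_mem fX.
  rewrite /= in_itv/= -ler_norml.
  have := @beta_ext_le f (supnorm f) p fb (fun x => supnorm_ub x fb).
  rewrite /beta_ext; case: pselect => [fb'|//].
  by rewrite (Prop_irrelevance (mem_set fb') fX).
Qed.

End stone_cech_compactification.

Section beta_ext_algebra.
Context {R : realType} {X : topologicalType}.
Implicit Types (f g : X -> R) (p : beta R X).

Lemma beta_extD f g : Cb R X f -> Cb R X g ->
  beta_ext (f + g) = beta_ext f + beta_ext g.
Proof.
move=> fb gb; apply: (eq_continuous_beta (@Rhausdorff R)).
- exact: beta_ext_continuous.
- by move=> p; apply: continuousD; exact: beta_ext_continuous.
- move=> x.
  transitivity (beta_ext f (to_beta R x) + beta_ext g (to_beta R x)) => //.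
  by rewrite !beta_ext_to_beta//; exact: CbD.
Qed.

Lemma beta_extM f g : Cb R X f -> Cb R X g ->
  beta_ext (f * g) = beta_ext f * beta_ext g.
Proof.
move=> fb gb; apply: (eq_continuous_beta (@Rhausdorff R)).
- exact: beta_ext_continuous.
- by move=> p; apply: continuousM; exact: beta_ext_continuous.
- move=> x.
  transitivity (beta_ext f (to_beta R x) * beta_ext g (to_beta R x)) => //.
  by rewrite !beta_ext_to_beta//; exact: CbM.
Qed.

Lemma beta_ext_cst (k : R) : beta_ext (fun _ : X => k) = fun=> k.
Proof.
apply: (eq_continuous_beta (@Rhausdorff R)).
- exact: beta_ext_continuous.
- by move=> p; exact: cst_continuous.
- by move=> x; rewrite beta_ext_to_beta//; exact: Cb_cst.
Qed.

Lemma beta_extZ k f : Cb R X f -> beta_ext (k *: f) = k *: beta_ext f.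
Proof.
by move=> fb; rewrite (beta_extM (Cb_cst k) fb) beta_ext_cst.
Qed.

End beta_ext_algebra.

(** * The points of lambda *)

Section lambda.
Context {R : realType} {X : topologicalType}.
Hypotheses (hausX : hausdorff_space X) (normX : normal_space X).

Lemma urysohn_Cb (A B : set X) : closed A -> closed B -> A `&` B = set0 ->
  exists f, [/\ Cb R X f, forall x, A x -> f x = 0 & forall x, B x -> f x = 1].
Proof.
move=> cA cB AB; apply: uniform_separator_Cb.
exact: (normal_separatorP (R := R)).1 normX _ _ cA cB AB.
Qed.

(** Complete regularity makes the embedding homeomorphic onto its image: the
    open set U is the trace of the union of the sets where the extension of f is
    nonzero, over all f vanishing off U. *)
Lemma to_beta_embedding : topological_embedding (@to_beta R X).
Proof.
have cl1 (x : X) : closed [set x] := hausdorff_closed1 hausX.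
split.
  move=> x y xy; apply: contrapT => nxy.
  have [//|//||f [fb fx fy]] := @urysohn_Cb [set x] [set y].
    by apply/seteqP; split=> // z [-> /nxy].
  have := beta_ext_to_beta x fb.
  rewrite xy beta_ext_to_beta// (fx x erefl) (fy y erefl).
  by move/eqP; rewrite oner_eq0.
move=> U; split=> [oU|[V oV <-]]; last first.
  by apply: open_comp => // x _; exact: to_beta_continuous.
exists (\bigcup_(f in [set f | Cb R X f /\ forall x, ~ U x -> f x = 0])
  (beta_ext f @^-1` [set r | r != 0])).
  apply: bigcup_open => f _; apply: open_comp; last exact: open_neq.
  by move=> p _; exact: beta_ext_continuous.
apply/seteqP; split=> x.
  case=> f [fb fU] /=; rewrite beta_ext_to_beta// => /eqP fx.
  by apply: contrapT => /fU.
move=> Ux; have [|//||f [fb fU fx]] := @urysohn_Cb (~` U) [set x].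
- exact: open_closedC.
- by apply/seteqP; split=> // z [nUz zx]; apply: nUz; rewrite zx.
- by exists f => //=; rewrite beta_ext_to_beta// fx// oner_neq0.
Qed.

Context (I : set (set X)).

Lemma C0I_bump A : closed A -> has_null_nbhd I A ->
  exists2 f, C0I R I f & forall x, A x -> f x = 1.
Proof.
move=> cA [U IU AU].
have [|//||f [fb fU fA]] := @urysohn_Cb (~` U°) A.
- by apply: open_closedC; exact: open_interior.
- by apply/seteqP; split=> // z [+ Az]; apply; exact: AU.
exists f => //; split=> // n n0; exists U => // x /(level_neq0 n0)/eqP fx.
by apply: contrapT => /fU.
Qed.

Lemma C0I_level f (e : R) : C0I R I f -> 0 < e ->
  has_null_nbhd I [set x | e <= `|f x|].
Proof.
move=> fC e0; apply: (vanishing_level _ fC e0) => [A B _||//].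
  exact: has_null_nbhdS.
exact: closed_norm_ge fC.1.1.
Qed.

(** The definition of lambda in terms of functions instead of cozero sets; this
    is the only form in which it is used. *)
Lemma lambdaP p : lambda R I p <-> exists2 f, C0I R I f & beta_ext f p != 0.
Proof.
split=> [[C [[h ch ->] nC]] /interior_subset pC|[f fC fp]].
  have [|f fC f1] := C0I_bump _ nC; first exact: closed_closure.
  exists f => //; suff -> : beta_ext f p = 1 by exact: oner_neq0.
  have cl1 : closed (beta_ext f @^-1` [set 1]).
    apply: closed_comp; last exact: closed_eq.
    by move=> q _; exact: beta_ext_continuous.
  apply: cl1; apply: closureS pC => _ [x hx <-] /=.
  by rewrite (beta_ext_to_beta _ fC.1) f1//; exact: subset_closure.
pose e := `|beta_ext f p| / 2.
have e0 : 0 < e by rewrite divr_gt0// normr_gt0.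
have cn : continuous (fun x => `|f x|).
  move=> x; apply: (continuous_comp (fC.1.1 x)); exact: norm_continuous.
pose C := [set x | e < `|f x|].
exists C; first split.
(* The set where |f| > e is the cozero set of the positive part of |f| - e. *)
- exists (fun x => Num.max (`|f x| - e) 0).
    move=> x; apply: (@continuous_max R X (fun x => `|f x| - e) (fun=> 0)).
      by apply: continuousB; [exact: cn|exact: cst_continuous].
    exact: cst_continuous.
  apply/seteqP; split=> x; rewrite /C /coz /=.
    move=> ex; rewrite max_l ?subr_ge0 1?ltW//.
    by move/eqP; rewrite subr_eq0 gt_eqF.
  by rewrite ltNge => h; apply/negP => fe; apply: h; rewrite max_r// subr_le0.
- apply: has_null_nbhdS (C0I_level fC e0).
  have cE : closed [set x | e <= `|f x|] := closed_norm_ge fC.1.1.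
  by rewrite [X in _ `<=` X](closure_id _).1//; apply: closureS => x; exact: ltW.
- have oE := open_norm_gt e (@beta_ext_continuous _ _ f).
  set V := [set q | _] in oE.
  suff : V `<=` closure (to_beta R (X:=X) @` C).
    rewrite open_subsetE//; apply; rewrite /V /=.
    by rewrite /e ltr_pdivrMr// ltr_pMr ?normr_gt0// ltr1n.
  (* X is dense, so it meets the open set V near each point q of V. *)
  move=> q /= eq B Bq.
  have [|x [/= ex Bx]] := @to_beta_dense _ _ q (V `&` B).
    apply: (@filterI _ (nbhs q) (nbhs_filter q)) => //.
    exact: open_nbhs_nbhs.
  exists (to_beta R x); split=> //; exists x => //.
  by move: ex; rewrite /V /= beta_ext_to_beta//; exact: fC.1.
Qed.

End lambda.

(** * The isometric isomorphism with C_0 of lambda *)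

Section C0_spaces.
Context {R : realType} {Z : topologicalType}.
Implicit Types f g : Z -> R.

Lemma compact_closed_subset (A B : set Z) :
  closed A -> A `<=` B -> compact B -> compact A.
Proof. by move=> cA AB cB; exact: subclosed_compact cB AB. Qed.

Lemma C0D f g : C0 R Z f -> C0 R Z g -> C0 R Z (f + g).
Proof. exact: (vanishingD (@compactU _) compact_closed_subset). Qed.

Lemma C0Z k f : C0 R Z f -> C0 R Z (k *: f).
Proof. exact: (vanishingZ compact_closed_subset). Qed.

Lemma C0B f g : C0 R Z f -> C0 R Z g -> C0 R Z (f - g).
Proof. exact: (vanishingB (@compactU _) compact_closed_subset). Qed.

Lemma C0Ml f h : Cb R Z f -> C0 R Z h -> C0 R Z (f * h).
Proof. exact: (vanishingMl compact_closed_subset). Qed.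

Lemma C0_norm_ge_compact f (e : R) : C0 R Z f -> 0 < e ->
  compact [set x | e <= `|f x|].
Proof.
move=> fC e0; apply: (vanishing_level compact_closed_subset fC e0) => //.
exact: closed_norm_ge fC.1.1.
Qed.

End C0_spaces.

(** The relation isometrically_isomorphic with its witness exposed, so that
    isomorphisms can be inverted and composed. *)
Definition isometric_isomorphism {R : realType} {X Y : topologicalType}
    (A : set (X -> R)) (B : set (Y -> R)) (Phi : (X -> R) -> (Y -> R)) :=
  [/\ set_bij A B Phi,
      forall f g, A f -> A g -> Phi (f + g) = Phi f + Phi g,
      forall (k : R) f, A f -> Phi (k *: f) = k *: Phi f,
      forall f g, A f -> A g -> Phi (f * g) = Phi f * Phi g &
      forall f, A f -> supnorm (Phi f) = supnorm f].

Section lambda_iso.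
Context {R : realType} {X : topologicalType}.
Hypotheses (hausX : hausdorff_space X) (normX : normal_space X).
Context (L I : set (set X)).
Hypotheses (semiL : upper_semilattice L) (idI : set_ideal L I).
Hypothesis locI : locally_null I.
Let Y : set (beta R X) := lambda R I.

Lemma C0I_empty_hull : empty_hull (C0I R I).
Proof.
split.
  apply: vanishing_ideal => [|A B|A B _]; first exact: has_null_nbhd0 idI.
    exact: has_null_nbhdU semiL idI _ _.
  exact: has_null_nbhdS.
move=> x.
have [f fC fx] := C0I_bump (R := R) normX (hausdorff_closed1 hausX) (locI x).
by exists f => //; rewrite fx// oner_neq0.
Qed.

Lemma to_beta_lambda x : Y (to_beta R x).
Proof.
have [_ /(_ x)[f fC fx]] := C0I_empty_hull.
by apply/(lambdaP normX I); exists f => //; rewrite (beta_ext_to_beta _ fC.1).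
Qed.

Definition to_lambda x : Y := SigSub (mem_set (to_beta_lambda x)).

Definition lambda_ext f (y : Y) : R := beta_ext f (set_val y).

Lemma lambda_ext_continuous f : continuous (lambda_ext f).
Proof.
move=> y; apply: (@continuous_comp Y (beta R X) R set_val (beta_ext f)).
  exact: set_val_continuous.
exact: beta_ext_continuous.
Qed.

Lemma lambda_ext_to_lambda f x : Cb R X f -> lambda_ext f (to_lambda x) = f x.
Proof. exact: beta_ext_to_beta. Qed.

Lemma to_lambda_continuous : continuous to_lambda.
Proof.
move=> x U /nbhs_set_val[V Vx VU].
have : \near x, V (to_beta R x) by exact: (to_beta_continuous Vx).
by apply: filterS => z Vz; exact: (VU (to_lambda z) Vz).
Qed.

Lemma to_lambda_dense (y : Y) (B : set Y) : nbhs y B -> exists x, B (to_lambda x).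
Proof.
move=> /nbhs_set_val[V Vy VB]; have [x Vx] := to_beta_dense Vy.
by exists x; exact: (VB (to_lambda x) Vx).
Qed.

(** Each point of lambda has a neighborhood on which some member of C^I_0(X)
    is bounded away from 0; local compactness and the null neighborhoods in
    C0_restrict both come from it. *)
Lemma lambda_nonvanishing (y : Y) : exists f (e : R),
  [/\ C0I R I f, 0 < e & nbhs y [set z | e < `|lambda_ext f z|]].
Proof.
have [f fC fy] := (lambdaP normX I (set_val y)).1 (set_valP y).
have e0 : 0 < `|lambda_ext f y| by rewrite normr_gt0.
exists f, (`|lambda_ext f y| / 2); split=> //; first by rewrite divr_gt0.
apply: open_nbhs_nbhs; split.
  by apply: open_norm_gt; exact: lambda_ext_continuous.
by rewrite /= ltr_pdivrMr// ltr_pMr// ltr1n.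
Qed.

(** The set where the extension of f has modulus at least 1/n is compact already
    in beta X, and lambda contains it by lambdaP. *)
Lemma lambda_ext_C0 f : C0I R I f -> C0 R Y (lambda_ext f).
Proof.
move=> fC; have [M M0 fM] := Cb_bound fC.1.
split.
  apply: (@continuous_Cb _ _ _ M) => // [|y]; first exact: lambda_ext_continuous.
  by apply: beta_ext_le => //; exact: fC.1.
move=> n n0; apply: compact_set_val.
rewrite (_ : _ @` _ = level (beta_ext f) n).
  apply: (subclosed_compact _ beta_compact) => //.
  by apply: closed_level; exact: beta_ext_continuous.
apply/seteqP; split=> [_ [y fy <-] //|p fp].
have Yp : Y p.
  by apply/(lambdaP normX I); exists f => //; exact: level_neq0 fp.
by exists (SigSub (mem_set Yp)).
Qed.

(** The compact set |g| >= 1/n is covered by open sets whose traces on X have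
    null neighborhoods, so its trace has one too. *)
Lemma C0_restrict (g : Y -> R) : C0 R Y g -> C0I R I (g \o to_lambda).
Proof.
move=> gC; have [M M0 gM] := Cb_bound gC.1.
split.
  apply: (@continuous_Cb _ _ _ M) => // x; last exact: gM.
  by apply: continuous_comp; [exact: to_lambda_continuous|exact: gC.1.1].
move=> n n0.
apply: (@compact_local_ideal Y (fun A => has_null_nbhd I (to_lambda @^-1` A))
  (level g n)); last exact: gC.2.
- by rewrite preimage_set0; exact: has_null_nbhd0 idI.
- by move=> A B; rewrite preimage_setU; exact: has_null_nbhdU semiL idI _ _.
- by move=> A B AB; apply: has_null_nbhdS => x; exact: AB.
- move=> y _; have [f [e [fC e0 fy]]] := lambda_nonvanishing y.
  exists [set z | e < `|lambda_ext f z|] => //.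
  apply: has_null_nbhdS (C0I_level fC e0) => x /=.
  by rewrite (lambda_ext_to_lambda _ fC.1); exact: ltW.
Qed.

Lemma lambda_ext_restrict (g : Y -> R) :
  C0 R Y g -> lambda_ext (g \o to_lambda) = g.
Proof.
move=> gC; apply: (continuous_eq_on_dense (@Rhausdorff R) to_lambda_dense).
- exact: lambda_ext_continuous.
- exact: gC.1.1.
- by move=> x; rewrite lambda_ext_to_lambda//; exact: (C0_restrict gC).1.
Qed.

Lemma lambda_ext_iso : isometric_isomorphism (C0I R I) (C0 R Y) lambda_ext.
Proof.
split.
- split.
  + by move=> f; exact: lambda_ext_C0.
  + move=> f g /set_mem fC /set_mem gC fg; apply/funext => x.
    rewrite -(lambda_ext_to_lambda x fC.1) fg lambda_ext_to_lambda//.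
    exact: gC.1.
  + move=> g gC; exists (g \o to_lambda); first exact: C0_restrict.
    exact: lambda_ext_restrict.
- by move=> f g fC gC; rewrite /lambda_ext (beta_extD fC.1 gC.1).
- by move=> k f fC; rewrite /lambda_ext (beta_extZ _ fC.1).
- by move=> f g fC gC; rewrite /lambda_ext (beta_extM fC.1 gC.1).
- move=> f fC; apply/eqP; rewrite eq_le; apply/andP; split.
    apply: supnorm_le => [|y]; first exact: supnorm_ge0 fC.1.
    apply: beta_ext_le => [|x]; [exact: fC.1|exact: supnorm_ub fC.1].
  apply: supnorm_le => [|x]; first exact: supnorm_ge0 (lambda_ext_C0 fC).1.
  rewrite -(lambda_ext_to_lambda x fC.1).
  exact: supnorm_ub (lambda_ext_C0 fC).1.
Qed.

Lemma lambda_locally_compact : locally_compact [set: Y].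
Proof.
move=> y _; have [f [e [fC e0 fy]]] := lambda_nonvanishing y.
exists [set z | e <= `|lambda_ext f z|]; last first.
  split; first exact: C0_norm_ge_compact (lambda_ext_C0 fC) e0.
  by apply: closed_norm_ge; exact: lambda_ext_continuous.
by move: fy; apply: (@filterS _ (nbhs y) (nbhs_filter y)) => z /ltW.
Qed.

(** Subtracting from f its truncation c to [-d, d] moves f by at most d and
    leaves a function supported in the set |f| >= d. *)
Lemma C00I_dense : supnorm_dense (C00I R I) (C0I R I).
Proof.
split=> [f [fb fs]|f fC e e0].
  split=> // n n0; apply: has_null_nbhdS fs => x /(level_neq0 n0)/eqP fx.
  exact: subset_closure.
pose d := e / 2; have d0 : 0 < d by rewrite divr_gt0.
pose c x := Num.max (- d) (Num.min (f x) d).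
have cd x : `|c x| <= d.
  by rewrite /c ler_norml le_max lexx ge_max ge_min lexx orbT andbT/=; lra.
have cb : Cb R X c.
  apply: (@continuous_Cb _ _ c d) => //; last exact: ltW.
  move=> x; apply: (@continuous_max R X (fun=> - d) (fun x => Num.min (f x) d)).
    exact: cst_continuous.
  apply: (@continuous_min R X f (fun=> d)); first exact: fC.1.1.
  exact: cst_continuous.
exists (f - c); last first.
  rewrite opprB addrCA subrr addr0 (@le_lt_trans _ _ d)//.
    by apply: supnorm_le => //; exact: ltW.
  by rewrite /d ltr_pdivrMr// ltr_pMr// ltr1n.
split; first exact: CbB fC.1 cb.
apply: has_null_nbhdS (C0I_level fC d0).
have cE : closed [set x | d <= `|f x|] := closed_norm_ge fC.1.1.
rewrite [X in _ `<=` X](closure_id _).1//; apply: closureS => x.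
move=> fcx /=; rewrite leNgt; apply/negP; rewrite ltr_norml => /andP[df fd].
apply: fcx; suff : f x - c x = 0 by [].
by rewrite /c min_l ?max_r ?subrr// ltW.
Qed.

(** All level sets of the constant 1 are X, and a neighborhood of X is X. *)
Lemma C0I_unit : C0I R I (fun=> 1) <-> I [set: X].
Proof.
split=> [[_ /(_ 1%N isT)[U IU XU]]|IX].
  suff <- : U = setT by [].
  apply/seteqP; split=> // x _; apply: interior_subset; apply: XU.
  by rewrite levelE normr1 invr1.
split; first exact: Cb_cst.
by move=> n _; exists setT => //; rewrite interiorT.
Qed.

(** A unit of C^I_0(X) takes the value 1 wherever some member of the algebra is
    nonzero, that is, everywhere. *)
Lemma C0I_unital : unital (C0I R I) <-> I [set: X].
Proof.
rewrite -C0I_unit; split=> [[u uC ul]|C1]; last first.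
  by exists (fun=> 1) => // f _; rewrite mul1r mulr1.
rewrite (_ : (fun=> 1) = u)//; apply/funext => x.
have [_ /(_ x)[h hC hx]] := C0I_empty_hull.
have /(congr1 (@^~ x)) := (ul h hC).1; rewrite fctE => uh.
by apply: (mulIf hx); rewrite uh mul1r.
Qed.

Lemma lambda_compact : I [set: X] <-> compact [set: Y].
Proof.
rewrite -C0I_unit; split=> [C1|cY].
  rewrite (_ : setT = [set y : Y | 1 <= `|lambda_ext (fun=> 1) y|]).
    exact: C0_norm_ge_compact (lambda_ext_C0 C1) ltr01.
  by apply/seteqP; split=> // y _; rewrite /= /lambda_ext beta_ext_cst normr1.
apply: (@C0_restrict (fun=> 1)); split; first exact: Cb_cst.
move=> n _; apply: subclosed_compact cY _ => //.
by apply: closed_level; exact: cst_continuous.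
Qed.

End lambda_iso.

(** * Inverses and composites of isometric isomorphisms *)

Section isometric_isomorphisms.
Context {R : realType}.

Lemma isometric_isomorphism_inv (X Y : topologicalType) (A : set (X -> R))
    (B : set (Y -> R)) Phi : subalgebra A -> subalgebra B ->
  isometric_isomorphism A B Phi ->
  exists Psi, [/\ isometric_isomorphism B A Psi,
    forall f, A f -> Psi (Phi f) = f & forall g, B g -> Phi (Psi g) = g].
Proof.
move=> [A0 AD AZ AM] [B0 BD BZ BM] [[PhiB Phi_inj Phi_surj] PhiD PhiZ PhiM PhiN].
have injA f g : A f -> A g -> Phi f = Phi g -> f = g.
  by move=> Af Ag; apply: Phi_inj; rewrite inE.
have /choice[Psi PsiP] : forall g, exists f, B g -> A f /\ Phi f = g.
  move=> g; have [/Phi_surj[f Af fg]|nBg] := pselect (B g); first by exists f.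
  by exists 0.
have PsiA g : B g -> A (Psi g) by case/PsiP.
have PsiK g : B g -> Phi (Psi g) = g by case/PsiP.
exists Psi; split=> //; last first.
  by move=> f Af; apply: injA => //; [exact/PsiA/PhiB|exact/PsiK/PhiB].
split.
- split=> // [g h /set_mem Bg /set_mem Bh gh|f Af].
    by rewrite -(PsiK _ Bg) gh PsiK.
  exists (Phi f); first exact: PhiB.
  by apply: injA => //; [exact/PsiA/PhiB|exact/PsiK/PhiB].
- move=> g h Bg Bh; apply: injA; [exact/PsiA/BD|by apply: AD; exact: PsiA|].
  by rewrite PhiD ?PsiK//; [exact: BD|exact: PsiA|exact: PsiA].
- move=> k g Bg; apply: injA; [exact/PsiA/BZ|by apply: AZ; exact: PsiA|].
  by rewrite PhiZ ?PsiK//; [exact: BZ|exact: PsiA].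
- move=> g h Bg Bh; apply: injA; [exact/PsiA/BM|by apply: AM; exact: PsiA|].
  by rewrite PhiM ?PsiK//; [exact: BM|exact: PsiA|exact: PsiA].
- by move=> g Bg; rewrite -PhiN ?PsiK//; exact: PsiA.
Qed.

Lemma isometric_isomorphism_comp (X Y Z : topologicalType) (A : set (X -> R))
    (B : set (Y -> R)) (C : set (Z -> R)) Phi Psi :
  isometric_isomorphism A B Phi -> isometric_isomorphism B C Psi ->
  isometric_isomorphism A C (Psi \o Phi).
Proof.
move=> [PhiAB PhiD PhiZ PhiM PhiN] [PsiBC PsiD PsiZ PsiM PsiN].
have PhiB f : A f -> B (Phi f) by case: PhiAB => + _ _; exact.
split.
- exact: set_bij_comp PhiAB PsiBC.
- by move=> f g Af Ag; rewrite /= PhiD// PsiD//; exact: PhiB.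
- by move=> k f Af; rewrite /= PhiZ// PsiZ//; exact: PhiB.
- by move=> f g Af Ag; rewrite /= PhiM// PsiM//; exact: PhiB.
- by move=> f Af; rewrite /= PsiN ?PhiN//; exact: PhiB.
Qed.

End isometric_isomorphisms.

(** * Characters of C_0 spaces *)

Section characters.
Context {R : realType} {Z : topologicalType}.
Implicit Types f g : Z -> R.

Lemma C0_subalgebra : subalgebra (C0 R Z).
Proof.
apply: vanishing_subalgebra; [exact: compact0|exact: compactU|].
exact: compact_closed_subset.
Qed.

Variable phi : (Z -> R) -> R.
Hypothesis phiD : forall f g, C0 R Z f -> C0 R Z g -> phi (f + g) = phi f + phi g.
Hypothesis phiZ : forall k f, C0 R Z f -> phi (k *: f) = k * phi f.
Hypothesis phiM : forall f g, C0 R Z f -> C0 R Z g -> phi (f * g) = phi f * phi g.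
Hypothesis phi_le : forall f, C0 R Z f -> `|phi f| <= supnorm f.

Let M f g (fC : C0 R Z f) (gC : C0 R Z g) : C0 R Z (f * g) := C0Ml fC.1 gC.

(** Suppose f^2 > 1 wherever |g| >= 1/2, let s be the norm of g, and put
    h = s f^2 and r = g / (1 + h).  As g = r + h r and phi h = 0, phi r = 1.
    But |r| <= s / (1 + s) where |g| >= 1/2 and |r| <= 1/2 elsewhere, so that
    the norm of r is less than 1. *)
Lemma character_kernel_small g f : C0 R Z g -> phi g = 1 ->
  C0 R Z f -> phi f = 0 -> exists2 z, 1 / 2 <= `|g z| & f z ^+ 2 <= 1.
Proof.
move=> gC g1 fC f0; apply: contrapT => nK.
pose s := supnorm g.
have s0 : 0 <= s by exact: supnorm_ge0 gC.1.
pose h := s *: (f * f).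
have hC : C0 R Z h by apply: C0Z; exact: M.
have hE z : h z = s * f z ^+ 2 by rewrite /h !fctE expr2.
have h0 z : 0 <= h z by rewrite hE mulr_ge0// sqr_ge0.
have s1 : 0 < 1 + s by rewrite ltr_wpDr.
have h1 z : 0 < 1 + h z by rewrite ltr_wpDr.
pose k z := (1 + h z)^-1.
have kb : Cb R Z k.
  apply: (@continuous_Cb _ _ k 1) => // z.
    apply: (continuousV (s := fun z => 1 + h z)); first by rewrite gt_eqF.
    exact: (CbD (Cb_cst 1) hC.1).1.
  by rewrite /k gtr0_norm ?invr_gt0// invf_le1// lerDl.
pose r := k * g.
have rC : C0 R Z r by exact: C0Ml.
have grh : g = r + h * r.
  apply/funext => z; suff : g z = k z * g z + h z * (k z * g z) by [].
  by rewrite /k; move: (h z) (h1 z) => t t1; field; rewrite gt_eqF.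
have ph : phi h = 0 by rewrite phiZ; [rewrite phiM// f0 mul0r mulr0|exact: M].
have r1 : phi r = 1.
  by rewrite -g1 [in RHS]grh phiD//; [rewrite (phiM hC rC) ph mul0r addr0|exact: M].
have : 1 <= Num.max (1 / 2) (s / (1 + s)).
  apply: (@le_trans _ _ `|phi r|); first by rewrite r1 normr1.
  apply: le_trans (phi_le rC) _; apply: supnorm_le.
    by rewrite le_max divr_ge0.
  move=> z; rewrite le_max.
  have -> : `|r z| = `|g z| / (1 + h z).
    rewrite [r z](_ : _ = k z * g z)// normrM mulrC /k normfV.
    by rewrite (ger0_norm (ltW (h1 z))).
  have [gz|gz] := leP (1 / 2) `|g z|.
    apply/orP; right; have fz : 1 < f z ^+ 2.
      by rewrite ltNge; apply/negP => fz; apply: nK; exists z.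
    have gs : `|g z| <= s by exact: supnorm_ub gC.1.
    apply: ler_pM => //; first by rewrite invr_ge0 ltW.
    rewrite lef_pV2 ?posrE//.
    by rewrite lerD2l hE ler_peMr// ltW.
  apply/orP; left; apply: le_trans (ltW gz).
  by rewrite ler_pdivrMr// ler_peMr// lerDl.
by rewrite le_max => /orP[|]; [lra|rewrite ler_pdivlMr; lra].
Qed.

(** The sets where |g| >= 1/2 and f^2 <= 1, for f in the kernel, are nonempty
    and directed downwards, hence have a cluster point z in a compact set.  The
    kernel is stable under scaling, so it vanishes at z; being a hyperplane, it
    determines phi up to a factor, which multiplicativity forces to be 1. *)
Lemma C0_character_eval g0 : C0 R Z g0 -> phi g0 != 0 ->
  exists z, forall f, C0 R Z f -> phi f = f z.
Proof.
move=> g0C g00; pose g := (phi g0)^-1 *: g0.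
have gC : C0 R Z g by exact: C0Z.
have g1 : phi g = 1 by rewrite phiZ// mulVf.
pose D := [set f | C0 R Z f /\ phi f = 0].
pose K := [set z | 1 / 2 <= `|g z|].
pose B f := K `&` [set z | f z ^+ 2 <= 1].
have D0 : D (0 *: g) by split; [exact: C0Z|rewrite phiZ// mul0r].
have PF : ProperFilter (filter_from D B).
  apply: filter_from_proper; last first.
    move=> f [fC f0].
    by have [z gz fz] := character_kernel_small gC g1 fC f0; exists z.
  apply: filter_from_filter; first by exists (0 *: g).
  (* (f^2 + f'^2)^2 <= 1 implies both f^2 <= 1 and f'^2 <= 1. *)
  move=> f f' [fC f0] [f'C f'0]; exists (f * f + f' * f').
    split; first by apply: C0D; exact: M.
    by rewrite phiD ?phiM ?f0 ?f'0 ?mul0r ?addr0//; exact: M.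
  move=> z [Kz].
  rewrite /mkset [X in X ^+ 2](_ : _ = f z ^+ 2 + f' z ^+ 2) => [ff|//].
  have := sqr_ge0 (f z); have := sqr_ge0 (f' z).
  by split; split=> //=; nra.
have cK : compact K by apply: C0_norm_ge_compact => //; lra.
have [|z [Kz Fz]] := cK _ PF; first by exists (0 *: g) => // z [].
exists z.
have kerz f : C0 R Z f -> phi f = 0 -> f z = 0.
  move=> fC f0; apply: contrapT => /eqP fz.
  (* A kernel element with value 2 at z exceeds 1 in modulus near z. *)
  pose f2 := (2 / f z) *: f.
  have f2C : C0 R Z f2 by exact: C0Z.
  have f2D : D f2 by split=> //; rewrite phiZ// f0 mulr0.
  have f2z : f2 z = 2 by exact: (mulfVK fz 2).
  have [||x [[_ /= xf2] xf1]] := Fz (B f2) [set x | 1 < `|f2 x|].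
  - by exists f2.
  - apply: open_nbhs_nbhs; split; first by apply: open_norm_gt; exact: f2C.1.1.
    by rewrite /= f2z ger0_norm// ltr1n.
  - move: xf2 xf1; rewrite /= -real_normK ?num_real// => xf2 xf1; nra.
(* g * g - g is in the kernel, so g z is idempotent. *)
have gz1 : g z = 1.
  have : (g * g - g) z = 0.
    apply: kerz; first by apply: C0B => //; exact: M.
    by rewrite -scaleN1r (phiD (M gC gC) (C0Z _ gC)) phiM// phiZ// g1; lra.
  move=> /eqP; rewrite subr_eq0 => /eqP gg.
  have gz0 : g z != 0 by rewrite -normr_gt0 (lt_le_trans _ Kz).
  by apply: (mulIf gz0); rewrite mul1r.
move=> f fC; have : (f - phi f *: g) z = 0.
  apply: kerz; first by apply: C0B => //; exact: C0Z.
  rewrite -scaleN1r scalerA (phiD fC (C0Z _ gC)) phiZ// g1.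
  by rewrite mulr1 mulN1r subrr.
move/eqP; rewrite subr_eq0 => /eqP fz.
by have -> : f z = phi f * g z by []; rewrite gz1 mulr1.
Qed.

End characters.

(** * The Banach-Stone theorem *)

Section banach_stone.
Context {R : realType}.

(** Complete regularity provides a function that is 0 at z and 1 off the
    interior of a compact neighborhood inside U; its difference from 1 has
    compact level sets. *)
Lemma C0_bump (Z : topologicalType) (z : Z) (U : set Z) :
  locally_compact [set: Z] -> hausdorff_space Z -> open U -> U z ->
  exists f, [/\ C0 R Z f, f z = 1 & forall x, ~ U x -> f x = 0].
Proof.
move=> lcZ hZ oU Uz.
have [K Kz [cK clK]] := lcZ z I.
have {}Kz : nbhs z K.
  by move: Kz; apply: (@filterS _ (nbhs z) (nbhs_filter z)) => x; apply.
pose V := U `&` K°.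
have oV : open V by apply: openI => //; exact: open_interior.
have Vz : V z by split.
have crZ := @locally_compact_completely_regular Z R lcZ hZ.
have [f [fb f0 fV]] := uniform_separator_Cb (R := R)
  (crZ z (~` V) (open_closedC oV) (fun nVz => nVz Vz)).
have fz : f z = 0 by exact: f0.
have gb : Cb R Z ((fun=> 1) - f) by apply: CbB => //; exact: Cb_cst.
have gV x : ~ V x -> ((fun=> 1) - f) x = 0.
  by move=> /fV fx; have -> : ((fun=> 1) - f) x = 1 - f x by []; rewrite fx subrr.
exists ((fun=> 1) - f); split.
- split=> // n n0; apply: subclosed_compact cK _.
    by apply: closed_level; exact: gb.1.
  move=> x /(level_neq0 n0)/eqP gx; apply: contrapT => nKx.
  by apply/gx/gV => -[_ /interior_subset].
- by have -> : ((fun=> 1) - f) z = 1 - f z by []; rewrite fz subr0.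
- by move=> x nUx; apply: gV => -[].
Qed.

Lemma C0_separates (Z : topologicalType) (x y : Z) :
  locally_compact [set: Z] -> hausdorff_space Z ->
  (forall f, C0 R Z f -> f x = f y) -> x = y.
Proof.
move=> lcZ hZ fxy; apply: contrapT => nxy.
have [f [fC fx fy]] := C0_bump lcZ hZ (closed_openC (hausdorff_closed1 hZ)) nxy.
by move: (fxy f fC); rewrite fx (fy y (fun h => h erefl)) => /eqP; rewrite oner_eq0.
Qed.

(** Following Phi by evaluation at z is a character of C_0(Y), so it is
    evaluation at a point F z.  Continuity of F: a bump at F z supported in W is
    carried by Phi to a function that is nonzero near z, and F maps the points
    where it is nonzero into W. *)
Lemma isometric_isomorphism_dual (Y Z : topologicalType) Phi :
  locally_compact [set: Y] -> hausdorff_space Y ->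
  locally_compact [set: Z] -> hausdorff_space Z ->
  isometric_isomorphism (C0 R Y) (C0 R Z) Phi ->
  exists2 F : Z -> Y, continuous F & forall f z, C0 R Y f -> Phi f z = f (F z).
Proof.
move=> lcY hY lcZ hZ [[PhiC _ Phi_surj] PhiD PhiZ PhiM PhiN].
have /choice[F FP] : forall z, exists y, forall f, C0 R Y f -> Phi f z = f y.
  move=> z; have [g [gC gz _]] := C0_bump lcZ hZ openT (Logic.I : setT z).
  have [g0 g0C g0g] := Phi_surj _ gC.
  apply: (@C0_character_eval R Y (fun f => Phi f z) _ _ _ _ g0) => //.
  - by move=> f f' fC f'C; rewrite PhiD.
  - by move=> k f fC; rewrite PhiZ.
  - by move=> f f' fC f'C; rewrite PhiM.
  - by move=> f fC; rewrite -PhiN//; apply: supnorm_ub; exact: (PhiC _ fC).1.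
  - by rewrite g0g gz oner_neq0.
exists F => [z V|f z fC]; last exact: FP.
rewrite nbhsE => -[W [oW Wz] WV].
have [f [fC fz fW]] := C0_bump lcY hY oW Wz.
have : nbhs z [set z' | 0 < `|Phi f z'|].
  apply: open_nbhs_nbhs; split; last by rewrite /= FP// fz normr1.
  by apply: open_norm_gt; exact: (PhiC _ fC).1.1.
apply: filterS => z' /=; rewrite FP// normr_gt0 => /eqP fz'.
by apply: WV; apply: contrapT => /fW.
Qed.

(** The point maps dual to Phi and to its inverse are inverse to each other,
    because C_0 functions separate points. *)
Lemma banach_stone (Y Z : topologicalType) Phi :
  locally_compact [set: Y] -> hausdorff_space Y ->
  locally_compact [set: Z] -> hausdorff_space Z ->
  isometric_isomorphism (C0 R Y) (C0 R Z) Phi -> homeomorphic Z Y.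
Proof.
move=> lcY hY lcZ hZ PhiI.
have [Psi [PsiI PsiK PhiK]] :=
  isometric_isomorphism_inv C0_subalgebra C0_subalgebra PhiI.
have [F cF FP] := isometric_isomorphism_dual lcY hY lcZ hZ PhiI.
have [G cG GP] := isometric_isomorphism_dual lcZ hZ lcY hY PsiI.
have [[PhiC _ _] _ _ _ _] := PhiI; have [[PsiC _ _] _ _ _ _] := PsiI.
exists F, G; split=> // [z|y].
  apply: (C0_separates lcZ hZ) => g gC.
  by rewrite -GP// -FP ?PhiK//; exact: PsiC.
apply: (C0_separates lcY hY) => f fC.
by rewrite -FP// -GP ?PsiK//; exact: PhiC.
Qed.

End banach_stone.

(** * The theorem *)

Theorem theorem3p9 (R : realType) (X : topologicalType)
    (hausX : hausdorff_space X) (normX : normal_space X)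
    (L I : set (set X)) (semiL : upper_semilattice L) (idI : set_ideal L I)
    (locI : locally_null I) :
  banach_algebra (C0I R I) supnorm /\
  (let Y : set (beta R X) := lambda R I in
   [/\ [/\ locally_compact [set: Y],
           hausdorff_space Y,
           isometrically_isomorphic (C0I R I) (C0 R Y) &
           forall Z : topologicalType,
             locally_compact [set: Z] -> hausdorff_space Z ->
             isometrically_isomorphic (C0I R I) (C0 R Z) ->
             homeomorphic Z Y],
       [/\ topological_embedding (@to_beta R X),
           range (@to_beta R X) `<=` Y &
           dense (set_val @^-1` range (@to_beta R X) : set Y)],
       empty_hull (C0I R I),
       supnorm_dense (C00I R I) (C0I R I) &
       (unital (C0I R I) <-> I [set: X]) /\
       (I [set: X] <-> compact [set: Y])]).
Proof.
have bC := null_vanishing_banach (R := R) semiL idI.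
split=> // Y.
have lcY : locally_compact [set: Y] by exact: lambda_locally_compact.
have hY : hausdorff_space Y by apply: hausdorff_set_type; exact: beta_hausdorff.
have PhiI := lambda_ext_iso (R := R) hausX normX semiL idI locI.
split.
- split=> //; first by exists (@lambda_ext R X I).
  move=> Z lcZ hZ [Psi PsiI].
  have [bCalg _ _] := bC.
  have [Phi' [Phi'I _ _]] := isometric_isomorphism_inv bCalg C0_subalgebra PhiI.
  exact: (banach_stone lcY hY lcZ hZ (isometric_isomorphism_comp Phi'I PsiI)).
- split; first exact: to_beta_embedding.
    by move=> _ [x _ <-]; exact: (to_beta_lambda hausX normX semiL idI locI).
  move=> O [y Oy] oO.
  have yO : nbhs y O by exact: open_nbhs_nbhs.
  have [x Ox] := to_lambda_dense hausX normX semiL idI locI yO.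
  by exists (to_lambda hausX normX semiL idI locI x); split=> //; exists x.
- exact: (C0I_empty_hull hausX normX semiL idI locI).
- exact: C00I_dense.
- split; first exact: (C0I_unital hausX normX semiL idI locI).
  exact: (lambda_compact hausX normX semiL idI locI).
Qed.
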